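(* Let $\mathscr{C}$ be a Fraïssé class. Then the Fraïssé limit of $\mathscr{C}$ is homomorphism-homogeneous if and only if $\mathscr{C}$ has the one-point homomorphism extension property (1PHEP).
   Context: Structures are first-order structures over a fixed countable signature. A Fraïssé class $\mathscr{C}$ is a class of finitely generated structures, countable up to isomorphism, closed under taking (isomorphic copies of) finitely generated substructures, with the joint embedding property and the amalgamation property. The Fraïssé limit of $\mathscr{C}$ is the unique (up to isomorphism) countable structure $F$ that is ultrahomogeneous (every isomorphism between finitely generated substructures of $F$ extends to an automorphism of $F$) and whose finitely generated substructures are, up to isomorphism, exactly the members of $\mathscr{C}$. A structure $A$ is homomorphism-homogeneous if any homomorphism $B\to C$ between finitely generated substructures $B,C$ of $A$ can be extended to an endomorphism of $A$. A structure $C$ is a one-point extension of its substructure $B$ if there is $x\in C\setminus B$ such that $C$ is generated by $B\cup\{x\}$. $\mathscr{C}$ has the 1PHEP if for any $B,B',C\in\mathscr{C}$ such that $C$ is a one-point extension of $B$, any surjective homomorphism $\varphi:B\to B'$ can be extended to a homomorphism $\varphi':C\to C'$ for some $C'\in\mathscr{C}$ containing $B'$ as a substructure. *)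

(* Defs.v *)
From mathcomp Require Import all_boot.
From mathcomp Require Import boolp classical_sets functions cardinality.

Set Implicit Arguments.
Unset Strict Implicit.
Unset Printing Implicit Defensive.

Local Open Scope classical_set_scope.

(* Constants are function symbols of arity 0. *)
Record signature := Signature {
  fun_symb : countType;
  rel_symb : countType;
  fun_arity : fun_symb -> nat;
  rel_arity : rel_symb -> nat }.

(* The carrier may be empty (when there are no constants). *)
Record structure (L : signature) := Structure {
  carrier :> Type;
  fun_interp : forall f : fun_symb L, (fun_arity f).-tuple carrier -> carrier;
  rel_interp : forall r : rel_symb L, (rel_arity r).-tuple carrier -> Prop }.

Section Structures.
Variable L : signature.
Implicit Types A B : structure L.

Definition fun_morphism A B (h : A -> B) : Prop :=
  forall (f : fun_symb L) (t : (fun_arity f).-tuple A),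
    h (fun_interp t) = fun_interp (map_tuple h t).

Definition homomorphism A B (h : A -> B) : Prop :=
  fun_morphism h /\
  forall (r : rel_symb L) (t : (rel_arity r).-tuple A),
    rel_interp t -> rel_interp (map_tuple h t).

Definition embedding A B (h : A -> B) : Prop :=
  [/\ injective h, fun_morphism h &
   forall (r : rel_symb L) (t : (rel_arity r).-tuple A),
     rel_interp t <-> rel_interp (map_tuple h t)].

Definition isomorphism A B (h : A -> B) : Prop := bijective h /\ embedding h.

Definition isomorphic A B : Prop := exists h : A -> B, isomorphism h.

Definition fun_closed A (X : set A) : Prop :=
  forall (f : fun_symb L) (t : (fun_arity f).-tuple A),
    (forall i, X (tnth t i)) -> X (fun_interp t).

Record substructure A := Substructure {
  universe : set A;
  universe_closed : fun_closed universe }.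

Lemma sub_fun_proof A (S : substructure A) (f : fun_symb L)
    (t : (fun_arity f).-tuple (set_type (universe S))) :
  fun_interp (map_tuple set_val t) \in universe S.
Proof.
apply/mem_set/universe_closed => i; rewrite tnth_map; exact: set_valP.
Qed.

Definition substructure_structure A (S : substructure A) : structure L :=
  @Structure L (set_type (universe S))
    (fun f t => exist _ (fun_interp (map_tuple set_val t)) (sub_fun_proof t))
    (fun r t => rel_interp (map_tuple set_val t)).
Coercion substructure_structure : substructure >-> structure.

Definition inclusion A (S : substructure A) (x : S) : A := set_val x.

Definition generated A (X : set A) : set A := smallest (@fun_closed A) X.

Definition finitely_generated A : Prop :=
  exists X : set A, finite_set X /\ generated X = [set: A].

Definition one_point_extension A (S : substructure A) : Prop :=
  exists x : A, ~ universe S x /\ generated (universe S `|` [set x]) = [set: A].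

Definition ultrahomogeneous A : Prop :=
  forall (S T : substructure A) (h : S -> T),
    finitely_generated S -> finitely_generated T -> isomorphism h ->
    exists g : A -> A,
      isomorphism g /\ forall x : S, g (inclusion x) = inclusion (h x).

Definition homomorphism_homogeneous A : Prop :=
  forall (S T : substructure A) (h : S -> T),
    finitely_generated S -> finitely_generated T -> homomorphism h ->
    exists g : A -> A,
      homomorphism g /\ forall x : S, g (inclusion x) = inclusion (h x).

Section Classes.
Variable C : structure L -> Prop.

Definition joint_embedding_property : Prop :=
  forall A B, C A -> C B ->
    exists D : structure L, C D /\
      exists (e : A -> D) (e' : B -> D), embedding e /\ embedding e'.

Definition amalgamation_property : Prop :=
  forall (A B B' : structure L) (e : A -> B) (e' : A -> B'),
    C A -> C B -> C B' -> embedding e -> embedding e' ->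
    exists D : structure L, C D /\
      exists (g : B -> D) (g' : B' -> D),
        [/\ embedding g, embedding g' & g \o e =1 g' \o e'].

Record fraisse_class : Prop := {
  fraisse_finitely_generated : forall A, C A -> finitely_generated A;
  fraisse_countable : exists D : nat -> structure L,
    forall A, C A -> exists n, isomorphic A (D n);
  (* Taking S to be all of A shows that C is closed under isomorphism. *)
  fraisse_hereditary : forall A (S : substructure A) B,
    C A -> finitely_generated S -> isomorphic B S -> C B;
  fraisse_JEP : joint_embedding_property;
  fraisse_AP : amalgamation_property }.

Record fraisse_limit (F : structure L) : Prop := {
  limit_countable : countable [set: F];
  limit_ultrahomogeneous : ultrahomogeneous F;
  limit_sub : forall S : substructure F, finitely_generated S -> C S;
  limit_universal : forall A, C A ->
    exists S : substructure F, finitely_generated S /\ isomorphic A S }.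

(* "M' contains B' as a substructure" is rendered by an embedding e of B'
   into M'; C is closed under isomorphism, so B' can be identified with its
   image. *)
Definition one_point_homomorphism_extension_property : Prop :=
  forall (M : structure L) (B : substructure M) (B' : structure L)
      (phi : B -> B'),
    C M -> C B -> C B' -> one_point_extension B ->
    homomorphism phi -> set_surj [set: B] [set: B'] phi ->
    exists (M' : structure L) (e : B' -> M') (phi' : M -> M'),
      [/\ C M', embedding e, homomorphism phi' &
          forall x : B, phi' (inclusion x) = e (phi x)].

End Classes.
End Structures.

(* Main.v *)
Require Import Defs.
From mathcomp Require Import all_boot.
From mathcomp Require Import boolp classical_sets functions cardinality.

Set Implicit Arguments.
Unset Strict Implicit.
Unset Printing Implicit Defensive.

Local Open Scope classical_set_scope.

(** Given 1PHEP, a homomorphism [f] into [F] from a finitely generated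
    substructure [S] of [F] extends to the substructure generated by [S] and
    one more point [x]: 1PHEP extends [f], seen as a map onto its image [B'],
    to a homomorphism into some [M'] in the class; embed [M'] into [F] and
    correct the two embeddings of [B'] by an automorphism, using
    ultrahomogeneity.  As [F] is countable, iterating and taking the union
    gives an endomorphism.  Conversely, if [F] is homomorphism-homogeneous,
    place [M] and [B'] inside [F], extend [phi] to an endomorphism [g] of [F],
    and let [M'] be the image of [M] under [g]. *)

(** * Tuples under maps *)

Lemma map_tuple_comp (T1 T2 T3 : Type) (g : T2 -> T3) (f : T1 -> T2) n
    (t : n.-tuple T1) :
  map_tuple g (map_tuple f t) = map_tuple (g \o f) t.
Proof. by apply: val_inj; rewrite /= -map_comp. Qed.

Lemma eq_map_tuple (T1 T2 : Type) (f g : T1 -> T2) n (t : n.-tuple T1) :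
  (forall i, f (tnth t i) = g (tnth t i)) -> map_tuple f t = map_tuple g t.
Proof. by move=> fg; apply: eq_from_tnth => i; rewrite !tnth_map. Qed.

Lemma map_tuple_id (T : Type) n (t : n.-tuple T) : map_tuple id t = t.
Proof. by apply: val_inj; rewrite /= map_id. Qed.

(** Preimages are chosen coordinate by coordinate. Keeping the lifted entries in [X] is what makes
    the image of a closed set closed. *)
Lemma lift_tuple (T1 T2 : Type) (h : T1 -> T2) (X : set T1) n
    (t : n.-tuple T2) :
  (forall i, (h @` X) (tnth t i)) ->
  exists2 s : n.-tuple T1, (forall i, X (tnth s i)) & map_tuple h s = t.
Proof.
move=> tX.
have [c cP] : {c : 'I_n -> T1 & forall i, X (c i) /\ h (c i) = tnth t i}.
  by apply: (@choice _ _ (fun i x => X x /\ h x = tnth t i)) => i;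
    have [x Xx hx] := tX i; exists x.
exists [tuple c i | i < n] => [i|].
  by rewrite tnth_mktuple; case: (cP i).
by apply: eq_from_tnth => i; rewrite tnth_map tnth_mktuple; case: (cP i).
Qed.

(** * Homomorphisms, embeddings and isomorphisms *)

Section Structures.
Variable L : signature.
Implicit Types A B D F : structure L.

Lemma embedding_homomorphism A B (h : A -> B) : embedding h -> homomorphism h.
Proof. by move=> [_ hf hr]; split=> // r t /hr. Qed.

Lemma homomorphism_comp A B D (g : B -> D) (f : A -> B) :
  homomorphism g -> homomorphism f -> homomorphism (g \o f).
Proof.
move=> [gf gr] [ff fr]; split=> [s t|r t /fr/gr].
  by rewrite /= ff gf map_tuple_comp.
by rewrite map_tuple_comp.
Qed.

Lemma embedding_comp A B D (g : B -> D) (f : A -> B) :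
  embedding g -> embedding f -> embedding (g \o f).
Proof.
move=> [gi gf gr] [fi ff fr]; split=> [|s t|r t].
- exact: inj_comp.
- by rewrite /= ff gf map_tuple_comp.
- by apply: (iff_trans (fr _ _)); rewrite -map_tuple_comp.
Qed.

Lemma isomorphism_inv A B (h : A -> B) (k : B -> A) :
  embedding h -> cancel h k -> cancel k h -> isomorphism k.
Proof.
move=> [hi hf hr] hk kh; split; first by exists h.
have khE n (t : n.-tuple B) : map_tuple h (map_tuple k t) = t.
  by rewrite map_tuple_comp -[RHS]map_tuple_id; apply: eq_map_tuple => i /=.
split=> [|s t|r t]; first exact: can_inj kh.
  by apply: hi; rewrite kh hf khE.
by apply: iff_sym; apply: (iff_trans (hr _ _)); rewrite khE.
Qed.

Lemma isomorphism_comp A B D (g : B -> D) (f : A -> B) :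
  isomorphism g -> isomorphism f -> isomorphism (g \o f).
Proof.
by move=> [gb ge] [fb fe]; split; [exact: bij_comp|exact: embedding_comp].
Qed.

Lemma inclusion_embedding A (S : substructure A) : embedding (@inclusion L A S).
Proof. by split=> //; exact: val_inj. Qed.

Lemma inclusionP A (S : substructure A) (x : S) : universe S (inclusion x).
Proof. exact: set_valP. Qed.

Definition sub_point A (S : substructure A) (a : A) (Sa : universe S a) : S :=
  exist _ a (mem_set Sa).

Arguments sub_point [A] S [a] Sa.

(** * Generated substructures and finite generation *)

Lemma generated_closed A (X : set A) : fun_closed (generated X).
Proof.
move=> s t tX Y [Yc XY]; apply: (Yc) => i; exact: (tX i Y (conj Yc XY)).
Qed.

Definition generated_substructure A (X : set A) : substructure A :=
  Substructure (@generated_closed A X).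

Lemma image_closed A B (h : A -> B) (X : set A) :
  fun_morphism h -> fun_closed X -> fun_closed (h @` X).
Proof.
move=> hf Xc s t /lift_tuple[u uX <-].
by exists (fun_interp u); [exact: Xc|rewrite hf].
Qed.

Lemma preimage_closed A B (h : A -> B) (Y : set B) :
  fun_morphism h -> fun_closed Y -> fun_closed (h @^-1` Y).
Proof.
by move=> hf Yc s t tY; rewrite /preimage /= hf; apply: Yc => i;
  rewrite tnth_map; exact: tY.
Qed.

Lemma sub_generated A (X : set A) : X `<=` generated X.
Proof. exact: sub_gen_smallest. Qed.

Lemma generated_sub A (X Y : set A) :
  fun_closed Y -> X `<=` Y -> generated X `<=` Y.
Proof. exact: smallest_sub. Qed.

Lemma generated_mono A (X Y : set A) :
  X `<=` Y -> generated X `<=` generated Y.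
Proof.
move=> XY; apply: generated_sub; first exact: generated_closed.
exact: subset_trans XY (@sub_generated _ _).
Qed.

Lemma generated_image A B (h : A -> B) (X : set A) :
  fun_morphism h -> generated (h @` X) = h @` generated X.
Proof.
move=> hf; apply/seteqP; split.
  apply: generated_sub; first exact: image_closed hf (@generated_closed _ _).
  exact: image_subset (@sub_generated _ _).
rewrite image_sub; apply: generated_sub.
  exact: preimage_closed hf (@generated_closed _ _).
by move=> x Xx; apply: sub_generated; exists x.
Qed.

(** Generation commutes with images, and injectivity of [e] pulls membership back. Generation inside
    a substructure can thus be checked in the ambient structure. *)
Lemma generated_full A B (e : A -> B) (Y : set A) :
  embedding e -> range e `<=` generated (e @` Y) -> generated Y = [set: A].
Proof.
move=> [ei ef _] sub; apply/seteqP; split=> // a _.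
have : generated (e @` Y) (e a) by apply: sub; exists a.
by rewrite generated_image// => -[b Yb /ei <-].
Qed.

(** The generators pull back along [e]: they lie in its range, so [e] maps [e @^-1] [X] onto [X],
    and injectivity keeps the preimage finite. *)
Lemma finitely_generated_embedding A B (e : A -> B) (X : set B) :
  embedding e -> finite_set X -> range e = generated X -> finitely_generated A.
Proof.
move=> ee Xfin eX; have [ei _ _] := ee.
exists (e @^-1` X); split.
  by apply: finite_preimage => // x y _ _; exact: ei.
apply: (generated_full ee).
suff -> : e @` (e @^-1` X) = X by rewrite eX.
apply/seteqP; split=> [_ [a Xa <-]//|x Xx].
by have : range e x; [rewrite eX; exact: sub_generated|
  move=> [a _ ax]; exists a => //; rewrite /preimage /= ax].
Qed.

Lemma generated_substructure_fg A (X : set A) :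
  finite_set X -> finitely_generated (generated_substructure X).
Proof.
move=> Xfin.
apply: (finitely_generated_embedding (inclusion_embedding _) Xfin).
apply/seteqP; split=> [_ [x _ <-]|x Xx]; first exact: (inclusionP x).
by exists (sub_point (generated_substructure X) Xx).
Qed.

(** * Corestrictions, images, and homogeneity along embeddings *)

Section Corestriction.
Variables (A B : structure L) (S : substructure B) (h : A -> B).
Hypothesis hS : forall a, universe S (h a).

Definition corestriction (a : A) : S := sub_point S (hS a).

Lemma corestriction_fun_morphism : fun_morphism h -> fun_morphism corestriction.
Proof.
by move=> hf s t; apply: val_inj; rewrite /= map_tuple_comp hf.
Qed.

Lemma corestriction_homomorphism : homomorphism h -> homomorphism corestriction.
Proof.
move=> [hf hr]; split; first exact: corestriction_fun_morphism.
by move=> r t /hr; rewrite /= map_tuple_comp.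
Qed.

Lemma corestriction_embedding : embedding h -> embedding corestriction.
Proof.
move=> [hi hf hr]; split; last 1 first.
- by move=> r t; apply: (iff_trans (hr _ _)); rewrite /= map_tuple_comp.
- by move=> a b [/hi].
- exact: corestriction_fun_morphism.
Qed.

End Corestriction.

Lemma range_closed A B (h : A -> B) : fun_morphism h -> fun_closed (range h).
Proof. by move=> hf; apply: image_closed. Qed.

Definition image_substructure A B (h : A -> B) (hh : homomorphism h) :
  substructure B := Substructure (range_closed hh.1).

Definition onto_image A B (h : A -> B) (hh : homomorphism h) :
    A -> image_substructure hh :=
  @corestriction A B (image_substructure hh) h (fun a => imageT h a).

Lemma onto_image_surj A B (h : A -> B) (hh : homomorphism h)
    (y : image_substructure hh) : exists a, onto_image hh a = y.
Proof.
by have [a _ ay] := inclusionP y; exists a; apply: val_inj.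
Qed.

Lemma image_substructure_fg A B (h : A -> B) (hh : homomorphism h) :
  finitely_generated A -> finitely_generated (image_substructure hh).
Proof.
move=> [X [Xfin XA]].
apply: (finitely_generated_embedding (inclusion_embedding _)
  (finite_image h Xfin)).
rewrite generated_image ?XA; last exact: hh.1.
apply/seteqP; split=> [_ [x _ <-]|_ [a _ <-]]; first exact: (inclusionP x).
by exists (onto_image hh a).
Qed.

(** Choice gives a right inverse [k] of the surjection onto the image; injectivity makes it a left
    inverse too. *)
Lemma onto_image_isomorphism A B (h : A -> B) (hh : homomorphism h) :
  embedding h -> exists2 k, isomorphism k & cancel (onto_image hh) k /\
    isomorphism (onto_image hh).
Proof.
move=> he.
have ee : embedding (onto_image hh) by exact: corestriction_embedding.
have [k kP] := choice (onto_image_surj (hh := hh)).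
have hk : cancel (onto_image hh) k by move=> a; case: ee => + _ _; apply.
exists k; first exact: (isomorphism_inv ee).
by split=> //; split=> //; exists k.
Qed.

(** Homogeneity is applied to the map from the image of [e] to the image of [h] that first inverts
    [e]. This form allows an abstract [A] in place of a substructure of [F]. *)
Lemma homomorphism_homogeneous_embedding F A (e h : A -> F) :
  homomorphism_homogeneous F -> finitely_generated A ->
  embedding e -> homomorphism h ->
  exists2 g : F -> F, homomorphism g & g \o e =1 h.
Proof.
move=> FH Afg ee hh; have eh := embedding_homomorphism ee.
have [k kiso [ke _]] := onto_image_isomorphism eh ee.
have [|g [gh gE]] := FH (image_substructure eh) (image_substructure hh)
  (onto_image hh \o k) (image_substructure_fg eh Afg)
  (image_substructure_fg hh Afg).
  apply: homomorphism_comp; last exact: embedding_homomorphism kiso.2.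
  exact: corestriction_homomorphism.
by exists g => // a; have := gE (onto_image eh a); rewrite /= ke.
Qed.

Lemma ultrahomogeneous_embedding F A (e h : A -> F) :
  ultrahomogeneous F -> finitely_generated A -> embedding e -> embedding h ->
  exists2 g : F -> F, isomorphism g & g \o e =1 h.
Proof.
move=> FU Afg ee he.
have eh := embedding_homomorphism ee; have hh := embedding_homomorphism he.
have [k kiso [ke _]] := onto_image_isomorphism eh ee.
have [_ _ [_ hiso]] := onto_image_isomorphism hh he.
have [|g [gh gE]] := FU (image_substructure eh) (image_substructure hh)
  (onto_image hh \o k) (image_substructure_fg eh Afg)
  (image_substructure_fg hh Afg); first exact: isomorphism_comp.
by exists g => // a; have := gE (onto_image eh a); rewrite /= ke.
Qed.

(** * Partial homomorphisms and the union of a chain *)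

Definition homomorphism_on A B (X : set A) (h : A -> B) : Prop :=
  (forall (f : fun_symb L) (t : (fun_arity f).-tuple A),
     (forall i, X (tnth t i)) -> h (fun_interp t) = fun_interp (map_tuple h t))
  /\ forall (r : rel_symb L) (t : (rel_arity r).-tuple A),
     (forall i, X (tnth t i)) -> rel_interp t -> rel_interp (map_tuple h t).

Lemma homomorphism_on_comp A B D (X : set B) (g : B -> D) (f : A -> B) :
  homomorphism_on X g -> homomorphism f -> (forall a, X (f a)) ->
  homomorphism (g \o f).
Proof.
move=> [gf gr] [ff fr] fX.
have tX n (t : n.-tuple A) i : X (tnth (map_tuple f t) i) by rewrite tnth_map.
split=> [s t|r t /fr/gr].
  by rewrite /= ff gf// map_tuple_comp.
by rewrite map_tuple_comp; exact.
Qed.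

(** Passes from maps on the carrier of [S] to total maps constrained only on a set. In this form all
    stages of a chain have type [F -> F] while their domains grow. *)
Lemma homomorphism_on_sub A B (S : substructure A) (h : S -> B) (g : A -> B) :
  homomorphism h -> (forall x : S, g (inclusion x) = h x) ->
  homomorphism_on (universe S) g.
Proof.
move=> [hf hr] gh.
have lift n (t : n.-tuple A) : (forall i, universe S (tnth t i)) ->
    exists u : n.-tuple S,
      t = map_tuple (@inclusion L A S) u /\ map_tuple g t = map_tuple h u.
  move=> tS; have [|u _ <-] := @lift_tuple S A (@inclusion L A S) setT n t.
    by move=> i; exists (sub_point S (tS i)).
  exists u; split=> //; rewrite map_tuple_comp.
  by apply: eq_map_tuple => i /=.
split=> [s t /lift[u [-> gu]]|r t /lift[u [-> gu]]]; rewrite gu.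
  have [_ + _] := inclusion_embedding S.
  by move=> /(_ s u) <-; rewrite gh hf.
by have [_ _ /(_ r u)] := inclusion_embedding S; move=> /iffRL/[apply]/hr.
Qed.

(** Values outside [S] are arbitrary defaults; the identity supplies them even when [A] is empty. *)
Lemma extend_by_id A (S : substructure A) (h : S -> A) :
  exists g : A -> A, forall x : S, g (inclusion x) = h x.
Proof.
exists (fun a => if pselect (universe S a) is left Sa
                 then h (sub_point S Sa) else a) => x.
case: pselect => [Sa|/(_ (inclusionP x))//].
by congr h; apply: val_inj.
Qed.

(** Points are coded by naturals through [c], and stage [n] adjoins the point with code [n]. Every
    tuple is finite, hence lies in a single stage, where preservation of functions and relations can
    be read off. *)
Lemma homomorphism_on_chain F (X : set F) (h : F -> F) :
  countable [set: F] ->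
  (forall (Y : set F) (f : F -> F) (x : F),
     finite_set Y -> homomorphism_on (generated Y) f ->
     exists2 f' : F -> F, homomorphism_on (generated (Y `|` [set x])) f' &
       forall y, generated Y y -> f' y = f y) ->
  finite_set X -> homomorphism_on (generated X) h ->
  exists2 g : F -> F, homomorphism g & forall x, generated X x -> g x = h x.
Proof.
move=> /countable_injP[c cinj] step Xfin hX.
pose P (s : set F * (F -> F)) :=
  finite_set s.1 /\ homomorphism_on (generated s.1) s.2.
(* The guard [P p.2] makes [R] total, so that [choice] yields a successor function on all pairs,
   valid stages or not. *)
pose R (p : nat * (set F * (F -> F))) (s' : set F * (F -> F)) :=
  P p.2 -> [/\ P s', p.2.1 `<=` s'.1,
    forall y, generated p.2.1 y -> s'.2 y = p.2.2 y &
    forall a, c a = p.1 -> s'.1 a].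
have [next nextP] : {next & forall p, R p (next p)}.
  apply: choice => -[n [Y f]]; rewrite /R /=.
  have [[Yfin fY]|nP] := pselect (P (Y, f)); last by exists (Y, f).
  (* If no point has code [n], the stage is repeated unchanged. *)
  have [[x cx]|nx] := pselect (exists x, c x = n); last first.
    by exists (Y, f) => _; split=> // a ca; case: nx; exists a.
  have [f' f'h f'E] := step Y f x Yfin fY.
  exists (Y `|` [set x], f') => _; split=> //=.
    by split=> //=; rewrite finite_setU.
  move=> a can; right; apply: cinj; rewrite ?in_setT//.
  by rewrite can cx.
pose u := fix u n := if n is m.+1 then next (m, u m) else (X, h).
have uP n : P (u n) by elim: n => [//|n /(nextP (n, u n))[]].
have uS n : [/\ (u n).1 `<=` (u n.+1).1,
    forall y, generated (u n).1 y -> (u n.+1).2 y = (u n).2 y &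
    forall a, c a = n -> (u n.+1).1 a].
  by have [] := nextP (n, u n) (uP n).
have umono m n : m <= n -> generated (u m).1 `<=` generated (u n).1.
  elim: n => [|n IH]; first by rewrite leqn0 => /eqP ->.
  rewrite leq_eqVlt => /predU1P[->//|/IH mn]; apply: subset_trans mn _.
  by apply: generated_mono; case: (uS n).
have ueq m n y : m <= n -> generated (u m).1 y -> (u n).2 y = (u m).2 y.
  move=> + my; elim: n => [|n IH]; first by rewrite leqn0 => /eqP ->.
  rewrite leq_eqVlt => /predU1P[->//|mn].
  have [_ uE _] := uS n; rewrite uE; first exact: IH.
  exact: umono my.
have ua a : generated (u (c a).+1).1 a.
  by apply: sub_generated; have [_ _] := uS (c a); exact.
(* The successor is needed: [a] is only guaranteed to be present after step [c a] has been carried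
   out. *)
pose g a := (u (c a).+1).2 a.
have gE n a : generated (u n).1 a -> g a = (u n).2 a.
  (* Either stage may be the later one, so both values are compared at their maximum. *)
  move=> na; rewrite /g -(ueq _ (maxn (c a).+1 n))// ?leq_maxl//.
  by rewrite (ueq n)// leq_maxr.
have bound k (t : k.-tuple F) :
    exists n, forall i, generated (u n).1 (tnth t i).
  exists (\max_(i < k) (c (tnth t i)).+1) => i.
  apply: umono (ua (tnth t i)).
  exact: (leq_bigmax_cond (F := fun i => (c (tnth t i)).+1)).
exists g; last by move=> x; exact: (gE 0).
split=> [s t|r t tr].
  have [n nt] := bound _ t; have [_ [uf _]] := uP n.
  rewrite (gE n); last exact: generated_closed.
  by rewrite uf//; congr fun_interp; apply: eq_map_tuple => i; rewrite (gE n).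
have [n nt] := bound _ t; have [_ [_ ur]] := uP n.
rewrite (_ : map_tuple g t = map_tuple (u n).2 t); first exact: ur.
by apply: eq_map_tuple => i; rewrite (gE n).
Qed.

(** * The two implications for a Fraïssé limit *)

Section FraisseLimit.
Variables (C : structure L -> Prop) (F : structure L).
Hypotheses (CF : fraisse_class C) (FC : fraisse_limit C F).

Lemma fraisse_class_embedding A B (e : A -> B) :
  C B -> finitely_generated A -> embedding e -> C A.
Proof.
move=> CB Afg ee; have eh := embedding_homomorphism ee.
have [_ _ [_ eiso]] := onto_image_isomorphism eh ee.
apply: (fraisse_hereditary CF CB (image_substructure_fg eh Afg)).
by exists (onto_image eh).
Qed.

(** The image of [e] is a finitely generated substructure of [F], hence in [C], and [A] embeds in
    it. *)
Lemma fraisse_limit_embedding A (e : A -> F) :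
  finitely_generated A -> embedding e -> C A.
Proof.
move=> Afg ee; have eh := embedding_homomorphism ee.
have [_ _ [_ [_ eemb]]] := onto_image_isomorphism eh ee.
apply: (fraisse_class_embedding _ Afg eemb).
exact: (limit_sub FC) (image_substructure_fg eh Afg).
Qed.

Lemma embeds_in_limit A : C A -> exists e : A -> F, embedding e.
Proof.
move=> /(limit_universal FC)[S [_ [h [_ he]]]].
by exists (@inclusion L F S \o h); apply: embedding_comp he;
  exact: inclusion_embedding.
Qed.

(** This is the step required by [homomorphism_on_chain]. *)
Lemma one_point_step (X : set F) (f : F -> F) (x : F) :
  one_point_homomorphism_extension_property C ->
  finite_set X -> homomorphism_on (generated X) f ->
  exists2 f' : F -> F, homomorphism_on (generated (X `|` [set x])) f' &
    forall y, generated X y -> f' y = f y.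
Proof.
move=> ext Xfin fX.
(* A one-point extension needs a new point; if [x] is already generated by [X], then [f] itself
   serves. *)
have [Xx|nXx] := pselect (generated X x).
  exists f => //; rewrite (_ : generated _ = generated X)//.
  apply/seteqP; split; last exact: generated_mono (@subsetUl _ _ _).
  apply: generated_sub; first exact: generated_closed.
  by move=> y [/sub_generated//|->].
pose M := generated_substructure (X `|` [set x]).
have iM := inclusion_embedding M.
have MX : generated X `<=` universe M by exact: generated_mono (@subsetUl _ _ _).
have Xxfin : finite_set (X `|` [set x]) by rewrite finite_setU.
have CM : C M.
  exact: fraisse_limit_embedding (generated_substructure_fg Xxfin) iM.
have iMf : fun_morphism (@inclusion L F M) by case: iM.
(* The 1PHEP wants the base as a substructure of [M], so the substructure of [F] generated by [X] is
   pulled back to [M]. *)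
pose B : substructure M := Substructure (preimage_closed iMf
  (@generated_closed _ X)).
have iB := embedding_comp iM (inclusion_embedding B).
have BX (b : B) : generated X (inclusion (inclusion b)) by exact: (inclusionP b).
have toB y : generated X y -> exists b : B, inclusion (inclusion b) = y.
  move=> Xy; pose m : M := sub_point M (MX _ Xy).
  have Bm : universe B m by [].
  by exists (sub_point B Bm).
have Bfg : finitely_generated B.
  apply: (finitely_generated_embedding iB Xfin).
  apply/seteqP; split=> [_ [b _ <-]|y /toB[b <-]]; first exact: BX.
  by exists b.
have CB : C B by exact: fraisse_limit_embedding iB.
have fB : homomorphism (f \o (@inclusion L F M \o @inclusion L M B)).
  exact: homomorphism_on_comp fX (embedding_homomorphism iB) BX.
pose B' := image_substructure fB.
have B'fg : finitely_generated B' by exact: image_substructure_fg.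
have CB' : C B'.
  exact: fraisse_limit_embedding B'fg (inclusion_embedding B').
have Mx : universe M x by apply: sub_generated; right.
pose xM : M := sub_point M Mx.
have ope : one_point_extension B.
  exists xM; split; first by [].
  apply: (generated_full iM) => _ [m _ <-].
  have := inclusionP m; apply: generated_mono => y [Xy|->].
    have [b by_] := toB y (sub_generated Xy).
    by exists (inclusion b) => //; left; exact: (inclusionP b).
  by exists xM => //; right.
have surj : set_surj [set: B] [set: B'] (onto_image fB).
  by move=> y _; have [b by_] := onto_image_surj y; exists b.
have [M' [e [phi' [CM' ee phi'h phi'E]]]] :=
  ext M B B' (onto_image fB) CM CB CB' ope
    (corestriction_homomorphism _ fB) surj.
have [k ke] := embeds_in_limit CM'.
(* Both [k \o e] and the inclusion embed [B'] in [F]. The automorphism [g] carries the first to the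
   second, so [g \o k \o phi'] agrees with [f] on [B]. *)
have [g giso gE] := ultrahomogeneous_embedding (limit_ultrahomogeneous FC)
  B'fg (embedding_comp ke ee) (inclusion_embedding B').
have hh : homomorphism (g \o (k \o phi')).
  apply: homomorphism_comp; first exact: embedding_homomorphism giso.2.
  by apply: homomorphism_comp phi'h; exact: embedding_homomorphism.
have [f' f'E] := extend_by_id (S := M) (g \o (k \o phi')).
exists f'; first exact: (homomorphism_on_sub hh f'E).
move=> y /toB[b <-]; rewrite f'E /= phi'E.
exact: gE.
Qed.

Lemma one_point_extension_homogeneous :
  one_point_homomorphism_extension_property C -> homomorphism_homogeneous F.
Proof.
move=> ext S T h Sfg Tfg hh.
have [f fE] := extend_by_id (@inclusion L F T \o h).
have fh := homomorphism_on_sub (homomorphism_comp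
  (embedding_homomorphism (inclusion_embedding T)) hh) fE.
have [X [Xfin XS]] := Sfg.
have iSf : fun_morphism (@inclusion L F S) by case: (inclusion_embedding S).
(* The chain starts from a finite set of points of [F], so the generators of [S] are moved into
   [F]. *)
have SE : generated (@inclusion L F S @` X) = universe S.
  rewrite generated_image// XS.
  apply/seteqP; split=> [_ [y _ <-]|y Sy]; first exact: (inclusionP y).
  by exists (sub_point S Sy).
rewrite -SE in fh.
have [|g gh gE] := homomorphism_on_chain (limit_countable FC) _
  (finite_image _ Xfin) fh.
  by move=> Y k x; exact: one_point_step.
exists g; split=> // y; rewrite gE ?fE//.
by rewrite SE; exact: (inclusionP y).
Qed.

Lemma homogeneous_one_point_extension :
  homomorphism_homogeneous F -> one_point_homomorphism_extension_property C.
Proof.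
move=> FH M B B' phi CM CB CB' _ phih surj.
have [i ie] := embeds_in_limit CM; have [j je] := embeds_in_limit CB'.
have [g gh gE] := homomorphism_homogeneous_embedding FH
  (fraisse_finitely_generated CF CB)
  (embedding_comp ie (inclusion_embedding B))
  (homomorphism_comp (embedding_homomorphism je) phih).
have gih := homomorphism_comp gh (embedding_homomorphism ie).
(* Surjectivity of [phi] enters here: writing [b] as [phi x], the point [j b] is the value of
   [g \o i] at [x], so [B'] embeds in the image of [M]. *)
have jM b : universe (image_substructure gih) (j b).
  have [x _ <-] := surj b I.
  by exists (inclusion x) => //; exact: gE.
exists (image_substructure gih), (corestriction jM), (onto_image gih); split.
- apply: (limit_sub FC); apply: image_substructure_fg.
  exact: (fraisse_finitely_generated CF CM).
- exact: corestriction_embedding.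
- exact: corestriction_homomorphism.
- by move=> x; apply: val_inj; exact: gE.
Qed.

End FraisseLimit.
End Structures.

Theorem proposition3p8 (L : signature) (C : structure L -> Prop)
    (F : structure L) :
  fraisse_class C -> fraisse_limit C F ->
  (homomorphism_homogeneous F <->
   one_point_homomorphism_extension_property C).
Proof.
move=> CF FC; split; first exact: homogeneous_one_point_extension.
exact: one_point_extension_homogeneous.
Qed.
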